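(* Let $K$ be a field, $R=K[x_1,x_2,x_3,x_4]$, and let $I\subseteq R$ be a monomial ideal generated in degree $d$. Then $I$ is a polymatroidal ideal if and only if $I(\mathfrak p)$ has a linear resolution for every monomial prime ideal $\mathfrak p\in\mathcal P(R)$.
   Context: For a monomial ideal $I$, $G(I)$ denotes its unique minimal set of monomial generators; $I$ is generated in degree $d$ if $G(I)$ is nonempty and all elements of $G(I)$ have degree $d$. A monomial ideal $I$ is polymatroidal if it is generated in a single degree and for all $u,v\in G(I)$ and every $i$ with $\deg_{x_i}(u)>\deg_{x_i}(v)$ there exists $j$ such that $\deg_{x_j}(v)>\deg_{x_j}(u)$ and $x_j(u/x_i)\in I$. $\mathcal P(R)$ is the set of monomial prime ideals of $R$, i.e. the ideals generated by subsets of the variables. For $\mathfrak p\in\mathcal P(R)$, $R(\mathfrak p)$ is the polynomial ring over $K$ in the variables belonging to $\mathfrak p$, and the monomial localization $I(\mathfrak p)\subseteq R(\mathfrak p)$ is the monomial ideal obtained from $I$ by substituting $1$ for every variable $x_i\notin\mathfrak p$; equivalently its extension to $R$ is $I:(\prod_{x_i\notin\mathfrak p}x_i)^\infty$. A monomial ideal has a linear resolution if it is generated in a single degree $e$ and its minimal graded free resolution is $e$-linear, i.e. its Castelnuovo-Mumford regularity equals $e$; the unit ideal (which arises as $I(\mathfrak p)$ when $I\not\subseteq\mathfrak p$) has a linear resolution, with $e=0$. *)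

(* Defs.v *)
From HB Require Import structures.
From mathcomp Require Import all_boot all_order all_algebra.
From mathcomp Require Import mpoly.
From mathcomp Require boolp.

Set Implicit Arguments.
Unset Strict Implicit.
Unset Printing Implicit Defensive.

Import GRing.Theory.
Local Open Scope ring_scope.

(* Ideals of a polynomial ring are Prop-valued predicates, compared
   extensionally; the structures of ring_quotient are not used because they
   exclude the unit ideal. *)

Section MonomialIdeals.
Variables (n : nat) (K : fieldType).
Implicit Types (I J p : {mpoly K[n]} -> Prop) (M : 'X_{1..n} -> Prop).

Definition same_ideal I J : Prop := forall f, I f <-> J f.

Definition ideal_gen (P : {mpoly K[n]} -> Prop) (f : {mpoly K[n]}) : Prop :=
  exists s : seq ({mpoly K[n]} * {mpoly K[n]}),
    (forall c, c \in s -> P c.2) /\ f = \sum_(c <- s) c.1 * c.2.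

Definition mono_gen M : {mpoly K[n]} -> Prop :=
  ideal_gen (fun g => exists2 m, M m & g = 'X_[m]).

Definition monomial_ideal I : Prop := exists M, same_ideal I (mono_gen M).

Definition minimal_generating_set I M : Prop :=
  same_ideal I (mono_gen M) /\
  forall M', (forall m, M' m -> M m) -> same_ideal I (mono_gen M') ->
    forall m, M m -> M' m.

(* G(I), as a set of exponent vectors: the minimal generating set is unique,
   so membership in some such set is membership in "the" one. *)
Definition mingens I (m : 'X_{1..n}) : Prop :=
  exists2 M, minimal_generating_set I M & M m.

Definition generated_in_degree I (d : nat) : Prop :=
  (exists m, mingens I m) /\ (forall m, mingens I m -> mdeg m = d).

Definition polymatroidal I : Prop :=
  [/\ monomial_ideal I,
      exists d, generated_in_degree I d &
      forall u v : 'X_{1..n}, mingens I u -> mingens I v ->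
      forall i : 'I_n, (v i < u i)%N ->
      exists2 j : 'I_n, (u j < v j)%N & I 'X_[((u - U_(i)) + U_(j))%MM]].

Definition monomial_prime p : Prop :=
  exists A : {set 'I_n},
    same_ideal p (ideal_gen (fun g => exists2 i, i \in A & g = 'X_i)).

Definition prime_vars p : {set 'I_n} := [set i | boolp.asbool (p 'X_i)].

End MonomialIdeals.

(* The polynomial ring in the variables of a set A is {mpoly K[#|A|]}, its j-th
   variable standing for the variable of index [enum_val j] in A. *)
Definition set_vars_to_one n (K : fieldType) (A : {set 'I_n}) (f : {mpoly K[n]}) :
    {mpoly K[#|A|]} :=
  f \mPo [tuple oapp (fun j => 'X_j) 1 [pick j : 'I_#|A| | enum_val j == i] | i < n].

(* Substitution is a surjective ring morphism, so the image of I is an ideal. *)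
Definition monomial_localization n (K : fieldType) (I p : {mpoly K[n]} -> Prop) :
    {mpoly K[#|prime_vars p|]} -> Prop :=
  fun g => exists2 f, I f & g = set_vars_to_one (prime_vars p) f.
Arguments monomial_localization {n K} I p _.

Section Resolutions.
Variables (n : nat) (K : fieldType).
Implicit Types (I : {mpoly K[n]} -> Prop).

Definition homog_of_degree (z : int) (f : {mpoly K[n]}) : Prop :=
  match z with Posz d => f \is d.-homog | Negz _ => f = 0 end.

(* A graded free resolution ... -> F_1 -> F_0 -> I -> 0, where F_i is the sum of
   the S(- fr_shift i k), k < fr_rank i.  Elements of F_i are row vectors and
   the maps act by right multiplication.  Finite resolutions have fr_rank i = 0
   for large i. *)
Record graded_free_resolution I := GradedFreeResolution {
  fr_rank : nat -> nat;
  fr_shift : forall i, 'I_(fr_rank i) -> int;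
  fr_aug : 'cV[{mpoly K[n]}]_(fr_rank 0);
  fr_diff : forall i, 'M[{mpoly K[n]}]_(fr_rank i.+1, fr_rank i);
  fr_aug_homog : forall k, homog_of_degree (fr_shift k) (fr_aug k ord0);
  fr_diff_homog : forall i (k : 'I_(fr_rank i.+1)) (l : 'I_(fr_rank i)),
    homog_of_degree (fr_shift k - fr_shift l) (fr_diff i k l);
  fr_aug_image : forall f : {mpoly K[n]},
    I f <-> exists w : 'rV_(fr_rank 0), f = (w *m fr_aug) ord0 ord0;
  fr_exact0 : forall v : 'rV_(fr_rank 0),
    v *m fr_aug = 0 <-> exists w : 'rV_(fr_rank 1), v = w *m fr_diff 0;
  fr_exactS : forall i (v : 'rV_(fr_rank i.+1)),
    v *m fr_diff i = 0 <-> exists w : 'rV_(fr_rank i.+2), v = w *m fr_diff i.+1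
}.

(* The image of F_(i+1) lies in the graded maximal ideal times F_i. *)
Definition minimal_resolution I (F : graded_free_resolution I) : Prop :=
  forall i k l, (fr_diff F i k l)@_0%MM = 0.

Definition linear_shifts I (F : graded_free_resolution I) (e : nat) : Prop :=
  forall i (k : 'I_(fr_rank F i)), fr_shift k = (e + i)%:Z.

(* Minimal graded free resolutions are unique up to isomorphism, so it suffices
   that one of them is e-linear. *)
Definition has_linear_resolution I : Prop :=
  exists2 e, generated_in_degree I e &
  exists2 F : graded_free_resolution I, minimal_resolution F & linear_shifts F e.

End Resolutions.

(* Main.v *)
(* The argument works in any number of variables.  Write [f A] for the least
   degree, over the monomials of [I], in the variables of [A]; it is the degree
   in which the localization [I(A)] at the prime generated by [A] is generated.

   If every [I(A)] has a linear resolution, then R/I(A) has no socle in degrees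
   at least [f A], so a monomial [u] of degree at least [f A] in [A] lies in
   [I(A)] as soon as it lies in all the localizations at proper subsets of [A].
   By induction on [A], the monomial [u] is in [I] iff [wt B u >= f B] for all
   [B].  A generator of [I(A :|: B)] of least degree in [A :&: B] shows that
   f(A) + f(B) <= f(A :|: B) + f(A :&: B), so the sets on which [u] is tight are
   closed under intersection, and the exchange property follows.

   Conversely, the localizations of a polymatroidal ideal are generated by sets
   with the exchange property, which have linear quotients in lexicographic
   order; iterated mapping cones turn linear quotients into linear
   resolutions. *)
Require Import Defs.
From mathcomp Require Import all_boot all_order all_algebra.
From mathcomp Require Import mpoly zify.
From mathcomp Require boolp.

Set Implicit Arguments.
Unset Strict Implicit.
Unset Printing Implicit Defensive.

Import Order.TTheory GRing.Theory.
Local Open Scope ring_scope.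

(** * Socles of ideals with a linear resolution *)

Lemma subr_swap (V : zmodType) (a b c : V) : b - c = (a - c) - (a - b).
Proof. by rewrite opprB addrCA addrAC subrr sub0r. Qed.

(** * Supports of polynomials and of matrices of polynomials *)

Section SupportConditions.
Variables (n : nat) (K : fieldType).
Implicit Types (p q : {mpoly K[n]}) (m : 'X_{1..n}) (P Q T : 'X_{1..n} -> Prop).

Definition psupp P p := forall m, m \in msupp p -> P m.

Lemma psupp0 P : psupp P 0.
Proof. by move=> m; rewrite mcoeff_msupp mcoeff0 eqxx. Qed.

Lemma psuppD P p q : psupp P p -> psupp P q -> psupp P (p + q).
Proof.
by move=> Pp Pq m /msuppD_le; rewrite mem_cat => /orP[/Pp|/Pq].
Qed.

Lemma psuppN P p : psupp P p -> psupp P (- p).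
Proof. by move=> Pp m; rewrite (perm_mem (msuppN p)); apply: Pp. Qed.

Lemma psupp_sum P (J : Type) (r : seq J) (F : J -> {mpoly K[n]}) :
  (forall j, psupp P (F j)) -> psupp P (\sum_(j <- r) F j).
Proof.
by move=> PF; apply: big_ind => //; [apply: psupp0 | apply: psuppD].
Qed.

Lemma psuppM P Q T p q : (forall a b, P a -> Q b -> T (a + b)%MM) ->
  psupp P p -> psupp Q q -> psupp T (p * q).
Proof.
move=> PQT Pp Qq m /msuppM_le /allpairsP[[a b] /= [/Pp Pa /Qq Qb ->]].
exact: PQT.
Qed.

Lemma psuppS P Q p : (forall m, P m -> Q m) -> psupp P p -> psupp Q p.
Proof. by move=> PQ Pp m /Pp /PQ. Qed.

Lemma psuppX P m : P m -> psupp P 'X_[m].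
Proof. by move=> Pm _ /mem_msuppXP <-. Qed.

Lemma psuppXP P m : psupp P 'X_[m] <-> P m.
Proof. by split=> [|/psuppX//]; apply; rewrite msuppX mem_head. Qed.

Lemma dhomog_psupp d p : p \is d.-homog <-> psupp (fun m => mdeg m = d) p.
Proof. by split=> [/dhomogP|] hp; first exact: hp; apply/dhomogP. Qed.

Definition mproj (P : pred 'X_{1..n}) p : {mpoly K[n]} :=
  \sum_(m <- msupp p | P m) p@_m *: 'X_[m].

Lemma mcoeff_mproj (P : pred _) p m : (mproj P p)@_m = if P m then p@_m else 0.
Proof.
have E q : (\sum_(k <- msupp p | P k) q@_k *: 'X_[K, k])@_m
   = \sum_(k <- msupp p | P k) q@_k * (k == m)%:R.
  by rewrite raddf_sum; apply: eq_bigr => k _ /=; rewrite mcoeffZ mcoeffX.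
rewrite /mproj E; case: ifP => Pm; last first.
  by apply: big1 => k Pk; case: eqP Pm => [<-|_]; rewrite ?Pk // mulr0.
have [ms|ms] := boolP (m \in msupp p).
  rewrite big_mkcond (bigD1_seq m) ?msupp_uniq //= Pm eqxx mulr1 big1 ?addr0 //.
  by move=> k /negbTE->; rewrite mulr0 if_same.
rewrite (memN_msupp_eq0 ms) big_seq_cond big1 // => k /andP[ks _].
by case: eqP ks ms => [-> ->|]; rewrite ?mulr0.
Qed.

Lemma psupp_mproj (P : pred 'X_{1..n}) Q p : psupp Q p ->
  psupp (fun m => P m /\ Q m) (mproj P p).
Proof.
move=> Qp m; rewrite mcoeff_msupp mcoeff_mproj; case: ifP => [Pm|]; last first.
  by rewrite eqxx.
by rewrite -mcoeff_msupp => /Qp.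
Qed.

Lemma psupp_mprojC (P : pred 'X_{1..n}) Q p : psupp Q p ->
  psupp (fun m => ~~ P m /\ Q m) (p - mproj P p).
Proof.
move=> Qp m; rewrite mcoeff_msupp mcoeffB mcoeff_mproj.
case: (boolP (P m)) => [Pm|nPm]; first by rewrite subrr eqxx.
by rewrite subr0 -mcoeff_msupp => /Qp.
Qed.

(** For [P] a degree condition this is homogeneity; for [P] the monomials of an ideal it is
    vanishing modulo that ideal. The socle argument combines both. *)
Definition mxsupp P a b (A : 'M[{mpoly K[n]}]_(a, b)) :=
  forall i j, psupp P (A i j).

Lemma mxsuppS P Q a b (A : 'M_(a, b)) :
  (forall m, P m -> Q m) -> mxsupp P A -> mxsupp Q A.
Proof. by move=> PQ PA i j; apply: psuppS (PA i j). Qed.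

Lemma mxsupp0 P a b : mxsupp P (0 : 'M_(a, b)).
Proof. by move=> i j; rewrite mxE; apply: psupp0. Qed.

Lemma mxsuppD P a b (A B : 'M_(a, b)) :
  mxsupp P A -> mxsupp P B -> mxsupp P (A + B).
Proof. by move=> PA PB i j; rewrite mxE; apply: psuppD. Qed.

Lemma mxsuppN P a b (A : 'M_(a, b)) : mxsupp P A -> mxsupp P (- A).
Proof. by move=> PA i j; rewrite mxE; apply: psuppN. Qed.

Lemma mxsuppB P a b (A B : 'M_(a, b)) :
  mxsupp P A -> mxsupp P B -> mxsupp P (A - B).
Proof. by move=> PA /mxsuppN; apply: mxsuppD. Qed.

Lemma mxsuppM P Q T a b c (A : 'M_(a, b)) (B : 'M_(b, c)) :
  (forall k l, P k -> Q l -> T (k + l)%MM) ->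
  mxsupp P A -> mxsupp Q B -> mxsupp T (A *m B).
Proof.
move=> PQT PA QB i j; rewrite mxE; apply: psupp_sum => l.
exact: psuppM (PA _ _) (QB _ _).
Qed.

Lemma mxsuppZ P Q T a b p (A : 'M_(a, b)) :
  (forall k l, P k -> Q l -> T (k + l)%MM) ->
  psupp P p -> mxsupp Q A -> mxsupp T (p *: A).
Proof. by move=> PQT Pp QA i j; rewrite mxE; apply: psuppM Pp (QA _ _). Qed.

Lemma mxsupp_eq0 P a b (A : 'M_(a, b)) :
  (forall m, ~ P m) -> mxsupp P A -> A = 0.
Proof.
move=> nP PA; apply/matrixP=> i j; rewrite mxE; apply: msuppnil0.
case E: (msupp (A i j)) => [//|m s]; case: (nP m); apply: (PA i j).
by rewrite E mem_head.
Qed.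

End SupportConditions.

Section Socle.
Variables (n : nat) (K : fieldType).
Implicit Types (S : {set 'I_n}) (m : 'X_{1..n}).

(* The monomials of the prime ideal generated by the variables in [S]. *)
Definition meets S m := exists2 i, i \in S & m i != 0%N.

Lemma meetsDl S k m : meets S k -> meets S (k + m)%MM.
Proof. by case=> i iS ki; exists i; rewrite ?mnmDE ?addn_eq0 ?negb_and ?ki. Qed.

Lemma meetsDr S k m : meets S k -> meets S (m + k)%MM.
Proof. by rewrite addmC; apply: meetsDl. Qed.

Lemma mxsupp_meetsM S a b c (A : 'M[{mpoly K[n]}]_(a, b)) (B : 'M_(b, c)) :
  mxsupp (meets S) A -> mxsupp (meets S) (A *m B).
Proof.
move=> SA; apply: (@mxsuppM _ _ (meets S) (fun=> True)) SA _ => // k l + _.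
exact: meetsDl.
Qed.

Lemma mxsupp_meetsZ S a b p (A : 'M[{mpoly K[n]}]_(a, b)) :
  mxsupp (meets S) A -> mxsupp (meets S) (p *: A).
Proof.
move=> SA; apply: (@mxsuppZ _ _ (fun=> True)) SA => // k l _.
exact: meetsDr.
Qed.

(** ['X_k] is a nonzerodivisor modulo the prime of [S]: multiplying by it changes no exponent in
    [S]. *)
Lemma mxsupp_meets_reg S k a b (A : 'M[{mpoly K[n]}]_(a, b)) : k \notin S ->
  mxsupp (meets S) ('X_k *: A) -> mxsupp (meets S) A.
Proof.
move=> kS SA i j m mA.
have /(SA i j) [l lS] : (U_(k) + m)%MM \in msupp (('X_k *: A) i j).
  by rewrite mxE mulrC mcoeff_msupp mcoeffMX -mcoeff_msupp.
rewrite mnmDE mnm1E; case: (k =P l) kS lS => [-> /negP nS /nS//|_ _ lS ml].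
by exists l.
Qed.

(** Dividing the terms that contain ['X_k] by it yields [B]; every other term involves a variable of
    [S]. *)
Lemma mxsupp_meets_split S k a b (A : 'M[{mpoly K[n]}]_(a, b)) :
  mxsupp (meets (k |: S)) A ->
  exists B, mxsupp (meets S) (A - 'X_k *: B).
Proof.
move=> SA; pose B := \matrix_(i, j)
  \sum_(m <- msupp (A i j) | m k != 0%N) (A i j)@_m *: 'X_[K, m - U_(k)].
exists B => i j; rewrite !mxE.
have -> : 'X_k * (\sum_(m <- msupp (A i j) | m k != 0%N)
     (A i j)@_m *: 'X_[K, m - U_(k)]) = mproj (fun m => m k != 0%N) (A i j).
  rewrite mulr_sumr; apply: eq_bigr => m mk.
  by rewrite -scalerAr -mpolyXD addmC submK // lep1mP.
apply: psuppS (psupp_mprojC (P := fun m => m k != 0%N) (SA i j)) => m [mk].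
by case=> l; rewrite !inE => /orP[/eqP->|lS ml]; [rewrite (negbTE mk)|exists l].
Qed.

Lemma mxsupp_meets_setU1 S k a b (A B C : 'M[{mpoly K[n]}]_(a, b)) :
  mxsupp (meets S) (A - 'X_k *: B - C) -> mxsupp (meets (k |: S)) (A - C).
Proof.
move=> SABC; rewrite -[A](subrK ('X_k *: B)) addrAC; apply: mxsuppD.
  by apply: mxsuppS SABC => m [l lS ml]; exists l; rewrite // inE lS orbT.
apply: (@mxsuppZ _ _ (fun m => m = U_(k)%MM) (fun=> True)) => //.
  move=> _ m -> _; exists k; first by rewrite !inE eqxx.
  by rewrite mnmDE mnm1E eqxx.
exact: psuppX.
Qed.

Definition linear_complex (r : nat -> nat)
    (D : forall i, 'M[{mpoly K[n]}]_(r i.+1, r i)) (e : nat) :=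
  [/\ mxsupp (fun m => mdeg m = e) (D 0%N),
      forall i, mxsupp (fun m => mdeg m = 1%N) (D i.+1) &
      forall i, D i.+1 *m D i = 0].

(** Exactness after reduction modulo the prime of [S], at every place but that of [r 0]. *)
Definition exact_modulo S (r : nat -> nat)
    (D : forall i, 'M[{mpoly K[n]}]_(r i.+1, r i)) :=
  forall i (v : 'rV_(r i.+1)), mxsupp (meets S) (v *m D i) ->
    exists w, mxsupp (meets S) (v - w *m D i.+1).

(* Killing one more variable ['X_k] and dropping the first module of the complex
   turns a socle element [g] into a lift [h] of ['X_k *: g], again a socle
   element; once all variables are killed, nothing of positive degree is left. *)
Lemma socle_modulo e S (r : nat -> nat)
    (D : forall i, 'M[{mpoly K[n]}]_(r i.+1, r i)) (g : 'rV_(r 0)) :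
  (0 < e)%N -> linear_complex D e -> exact_modulo S D ->
  mxsupp (fun m => e <= mdeg m)%N g ->
  (forall k, k \notin S ->
     exists w, mxsupp (meets S) ('X_k *: g - w *m D 0)) ->
  exists w, mxsupp (meets S) (g - w *m D 0).
Proof.
move: {2}#|~: S| (erefl #|~: S|) => N.
elim: N => [|N IH] in e S r D g *.
  (* All variables are killed here, and every monomial of [g] has positive degree, so [w = 0]
     works. *)
  move=> /cards0_eq /(congr1 (@setC _)); rewrite setCK setC0 => -> e_gt0 _ _ og _.
  exists 0; rewrite mul0mx subr0 => i j m /og le.
  have : mdeg m != 0%N by rewrite -lt0n (leq_trans e_gt0).
  rewrite mdeg_eq0 => m0; have [l ml|l0] := pickP (fun l => m l != 0%N).
    by exists l; rewrite ?inE.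
  by case/eqP: m0; apply/mnmP=> l; rewrite mnm0E; apply/eqP/negbFE/l0.
move=> cS e_gt0 [D0 DS DD] exD og gS.
have [k kS] : exists k, k \notin S.
  have /card_gt0P[k] : (0 < #|~: S|)%N by rewrite cS.
  by rewrite inE => kS; exists k.
have [h hS] := gS k kS.
(* Without its constant terms the lift has degree at least [1], as the induction hypothesis for [D']
   with [e = 1] demands. *)
pose low := map_mx (mproj (fun m => mdeg m == 0%N)) h.
pose h' := h - low.
have h'S : mxsupp (meets S) ('X_k *: g - h' *m D 0).
  (* [low *m D 0] is the degree [e] part of [h *m D 0], hence up to sign that of
     ['X_k *: g - h *m D 0], as ['X_k *: g] lives in degrees above [e]. *)
  have lowE : mxsupp (fun m => mdeg m = e) (low *m D 0).
    apply: (@mxsuppM _ _ (fun m => mdeg m = 0%N) (fun m => mdeg m = e)) D0.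
      by move=> a b; rewrite mdegD => -> ->.
    move=> i j; rewrite mxE.
    apply: psuppS (psupp_mproj (P := fun m => mdeg m == 0%N)
       (Q := fun=> True) _) => // m [/eqP//].
  have highE : mxsupp (fun m => e < mdeg m)%N ('X_k *: g - h' *m D 0).
    apply: mxsuppB.
      apply: (@mxsuppZ _ _ (fun m => mdeg m = 1%N)) _ og => [a b|].
        by rewrite mdegD => ->.
      by apply: psuppX; rewrite mdeg1.
    apply: (@mxsuppM _ _ (fun m => 0 < mdeg m)%N _) _ _ D0 => [a b|].
      by rewrite mdegD => a0 ->; rewrite -[X in (X < _)%N]add0n ltn_add2r.
    move=> i j; rewrite !mxE.
    apply: psuppS (psupp_mprojC (P := fun m => mdeg m == 0%N)
       (Q := fun=> True) _) => // m [+ _]; by rewrite lt0n.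
  move=> i j m mh'; have me := highE i j m mh'.
  have low0 : ((low *m D 0) i j)@_m = 0.
    by apply/memN_msupp_eq0/negP => /(lowE i j m) E; rewrite E ltnn in me.
  apply: (hS i j m); move: mh'.
  have -> : 'X_k *: g - h' *m D 0 = ('X_k *: g - h *m D 0) + low *m D 0.
    by rewrite /h' mulmxBl opprB addrA addrAC.
  by rewrite !mcoeff_msupp mxE mcoeffD low0 addr0.
have oh' : mxsupp (fun m => 1 <= mdeg m)%N h'.
  move=> i j; rewrite !mxE.
  apply: psuppS (psupp_mprojC (P := fun m => mdeg m == 0%N)
     (Q := fun=> True) _) => // m [+ _]; by rewrite lt0n.
pose D' i := D i.+1.
have linD' : linear_complex D' 1 by split.
(* Modulo [S], a cycle [v] modulo [k |: S] has [v *m D i.+1] equal to some ['X_k *: w]. Cancelling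
   ['X_k] makes [w] a cycle, hence a boundary [w' *m D i.+1], and then [v - 'X_k *: w'] is a
   cycle. *)
have exD' : exact_modulo (k |: S) D'.
  move=> i v vS.
  have [w wS] := mxsupp_meets_split vS.
  have wDS : mxsupp (meets S) (w *m D i).
    apply: (@mxsupp_meets_reg S k) => //.
    have := mxsupp_meetsM (B := D i) wS; rewrite mulmxBl -mulmxA DD mulmx0 sub0r.
    by rewrite -scalemxAl => /mxsuppN; rewrite opprK.
  have [w' w'S] := exD i w wDS.
  have [|w'' w''S] := exD i.+1 (v - 'X_k *: w').
    rewrite mulmxBl -scalemxAl.
    have -> : v *m D i.+1 - 'X_k *: (w' *m D i.+1) =
      (v *m D i.+1 - 'X_k *: w) + 'X_k *: (w - w' *m D i.+1).
      by rewrite scalerBr addrA subrK.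
    by apply: mxsuppD => //; apply: mxsupp_meetsZ.
  by exists w''; apply: mxsupp_meets_setU1 w''S.
have cS' : #|~: (k |: S)| = N.
  apply/eqP; rewrite -eqSS -cS (cardsD1 k (~: S)) inE kS add1n eqSS.
  by apply/eqP/eq_card => l; rewrite !inE negb_or.
have [|s sS] := IH 1%N (k |: S) (fun i => r i.+1) D' h' cS' isT linD' exD' oh'.
  move=> l lS.
  have [lk lS'] : l != k /\ l \notin S by move: lS; rewrite !inE => /norP[].
  (* Both ['X_l *: h'] and ['X_k *: u] lift the product of [g] by ['X_k] and ['X_l], so their
     difference is a boundary modulo [S]. *)
  have [u uS] := gS l lS'.
  have [|y yS] := exD 0 ('X_l *: h' - 'X_k *: u).
    rewrite mulmxBl -!scalemxAl.
    have -> : 'X_l *: (h' *m D 0) - 'X_k *: (u *m D 0) =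
      'X_k *: ('X_l *: g - u *m D 0) - 'X_l *: ('X_k *: g - h' *m D 0).
      by rewrite !scalerBr !scalerA (mulrC 'X_l 'X_k); apply: subr_swap.
    by apply: mxsuppB; apply: mxsupp_meetsZ => //.
  by exists y; apply: mxsupp_meets_setU1 yS.
(* Modulo [S], [h'] is [s *m D 1 + 'X_k *: t]; applying [D 0] and cancelling ['X_k] shows that [g]
   is [t *m D 0]. *)
have [t tS] := mxsupp_meets_split sS.
exists t; apply: (@mxsupp_meets_reg S k) => //.
have -> : 'X_k *: (g - t *m D 0) = ('X_k *: g - h' *m D 0) +
   (h' - s *m D 1 - 'X_k *: t) *m D 0.
  rewrite !mulmxBl -mulmxA DD mulmx0 subr0 -scalemxAl scalerBr.
  by rewrite addrA subrK.
by apply: mxsuppD => //; apply: mxsupp_meetsM.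
Qed.

End Socle.

(** * Linear resolutions and mapping cones *)

Section LinearResolutions.
Variables (n : nat) (K : fieldType).
Implicit Types (I J : {mpoly K[n]} -> Prop) (m u : 'X_{1..n}).

(** Ranks in a resolution of [R/I]: the ring itself in place [0], then a resolution of [I]. *)
Definition rk (r : nat -> nat) (i : nat) := if i is j.+1 then r j else 1%N.

(* The augmentation of a resolution of [I] is its differential [D 0]. *)
Definition linearly_resolved I e :=
  exists r : nat -> nat,
  exists D : forall i, 'M[{mpoly K[n]}]_(rk r i.+1, rk r i),
  [/\ linear_complex D e,
      forall f, I f <-> exists w : 'rV_(rk r 1), f = (w *m D 0%N) ord0 ord0 &
      forall i (v : 'rV_(rk r i.+1)),
        v *m D i = 0 -> exists w, v = w *m D i.+1].

Lemma linearly_resolved_ext I J e :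
  same_ideal I J -> linearly_resolved I e -> linearly_resolved J e.
Proof.
move=> IJ [r [D [? DI ?]]]; exists r, D; split=> // f.
by rewrite -DI; split=> /IJ.
Qed.

Lemma has_linear_resolutionP I :
  has_linear_resolution I <->
  exists2 e, generated_in_degree I e & linearly_resolved I e.
Proof.
split=> [[e Ie [F _ Fe]]|[e Ie [r [D [[D0 DS DD] DI exD]]]]]; exists e => //.
  exists (fr_rank F), (fun i => match i return 'M_(rk (fr_rank F) i.+1,
    rk (fr_rank F) i) with 0%N => fr_aug F | j.+1 => fr_diff F j end).
  split; first split.
  - move=> k l; rewrite (ord1 l) -dhomog_psupp.
    by have := fr_aug_homog (g := F) k; rewrite Fe addn0.
  - move=> i k l; rewrite -dhomog_psupp.
    have := fr_diff_homog (g := F) k l; rewrite !Fe addnS -addn1 PoszD.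
    by rewrite addrAC subrr add0r.
  - case=> [|i]; apply/row_matrixP => k; rewrite row0 row_mul rowE.
      by apply: (fr_exact0 (g := F) _).2; exists (delta_mx 0 k).
    by apply: (fr_exactS (g := F) _).2; exists (delta_mx 0 k).
  - exact: fr_aug_image.
  - by case=> [|i] v; [case: (fr_exact0 (g := F) v) | case: (fr_exactS (g := F) v)].
unshelve eexists.
  refine (@GradedFreeResolution n K I r (fun i _ => (e + i)%:Z) (D 0%N)
    (fun i => D i.+1) _ _ _ _ _).
  - by move=> k; rewrite /= addn0 dhomog_psupp; apply: D0.
  - move=> i k l; rewrite addnS -addn1 PoszD addrAC subrr add0r /=.
    by rewrite dhomog_psupp; apply: DS.
  - exact: DI.
  - move=> v; split=> [vD|[w ->]]; [exact: exD | by rewrite -mulmxA DD mulmx0].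
  - move=> i v; split=> [vD|[w ->]]; [exact: exD | by rewrite -mulmxA DD mulmx0].
(* Minimality: a linear form has no constant term. *)
- move=> i k l /=; apply: memN_msupp_eq0; apply/negP => /(DS i k l).
  by rewrite mdeg0.
- by [].
Qed.

(** Any lift may be replaced by its part of degree [d]: the error then has all its monomials in
    degree [d + d'] and none there. *)
Lemma homogeneous_lift a b c d d' (X : 'M[{mpoly K[n]}]_(a, c))
    (B : 'M_(b, c)) :
  mxsupp (fun m => mdeg m = d + d')%N X -> mxsupp (fun m => mdeg m = d') B ->
  (forall i, exists w, row i X = w *m B) ->
  exists2 W, mxsupp (fun m => mdeg m = d) W & X = W *m B.
Proof.
move=> Xdd' Bd' /boolp.choice[w wE].
pose W0 := \matrix_i w i.
have XE : X = W0 *m B.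
  by apply/row_matrixP => i; rewrite row_mul rowK -wE.
pose W := map_mx (mproj (fun m => mdeg m == d)) W0.
have Wd : mxsupp (fun m => mdeg m = d) W.
  move=> i j; rewrite mxE.
  apply: psuppS (psupp_mproj (P := fun m => mdeg m == d)
    (Q := fun=> True) _) => // m [/eqP//].
exists W => //; apply/eqP; rewrite -subr_eq0; apply/eqP.
apply: (@mxsupp_eq0 _ _ (fun m => mdeg m = d + d' /\ mdeg m <> d + d')%N).
  by move=> m [].
have S1 : mxsupp (fun m => mdeg m = d + d')%N (X - W *m B).
  apply: mxsuppB => //; apply: mxsuppM Wd Bd' => k l.
  by rewrite mdegD => -> ->.
have S2 : mxsupp (fun m => mdeg m <> d + d')%N (X - W *m B).
  rewrite XE -mulmxBl.
  apply: (@mxsuppM _ _ (fun m => mdeg m <> d)) _ Bd' => [k l kd ld'|i j].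
    by rewrite mdegD ld' => /addIn.
  rewrite !mxE; apply: psuppS (psupp_mprojC (P := fun m => mdeg m == d)
    (Q := fun=> True) _) => // m [/eqP//].
by move=> i j m mX; split; [apply: S1 mX | apply: S2 mX].
Qed.

(* The resolution is the mapping cone of a lift of the multiplication by [p]
   from the resolution of [R/J] to that of [R/I]. *)
Lemma linearly_resolved_cone I J e p :
  linearly_resolved I e -> linearly_resolved J 1 -> p \is e.-homog ->
  (forall f, J f <-> I (f * p)) ->
  linearly_resolved (fun f => exists g h, I g /\ f = g + h * p) e.
Proof.
move=> [r [A [[A0 AS AA] AI exA]]] [c [C [[C0 CS CC] CJ exC]]] hp colon.
(* [psi] is one component of the comparison map. That [C i *m psi] lands in the image of [A i]
   allows the next component to be chosen; the sign in [step] makes the cone a complex. *)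
pose good i (psi : 'M[{mpoly K[n]}]_(rk c i, rk r i)) :=
  mxsupp (fun m => mdeg m = if i is 0 then e else 1%N) psi /\
  forall v : 'rV_(rk c i.+1), exists w, v *m C i *m psi = w *m A i.
have good0 : good 0%N p%:M.
  split=> [i j|v]; first by rewrite !ord1 mxE eqxx -dhomog_psupp.
  have /colon : J ((v *m C 0%N) ord0 ord0) by apply/CJ; exists v.
  rewrite AI => -[w wE]; exists w; rewrite mul_mx_scalar.
  by apply/matrixP=> i j; rewrite !ord1 mxE mulrC wE.
have step i psi : good i psi ->
    exists psi', good i.+1 psi' /\ psi' *m A i = - (C i *m psi).
  move=> [psiE psiA].
  have [||k|W WE Wpsi] := @homogeneous_lift (rk c i.+1) _ _ 1
     (if i is 0 then e else 1%N) (- (C i *m psi)) (A i).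
  - apply: mxsuppN; apply: (@mxsuppM _ _ (fun m => mdeg m = 1%N)) psiE => [k l|].
      by rewrite mdegD => -> ->.
    by case: (i) => [|?]; [apply: C0 | apply: CS].
  - by case: (i) => [|?]; [apply: A0 | apply: AS].
  - have [w wE] := psiA (delta_mx ord0 k).
    by exists (- w); rewrite mulNmx -wE linearN /= -mulmxA -rowE.
  exists W; split; last by rewrite Wpsi.
  split=> // v; apply: exA; rewrite -!mulmxA -Wpsi !mulmxN !mulmxA.
  by rewrite -(mulmxA v) CC mulmx0 mul0mx oppr0.
pose Psi := nat_rect (fun i => {psi | good i psi}) (exist _ _ good0)
  (fun i x => let y := boolp.cid (step i (sval x) (svalP x)) in
     exist _ (sval y) (svalP y).1).
pose psi i := sval (Psi i).
have psi0 : psi 0%N = p%:M by [].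
have psiS i : psi i.+1 *m A i = - (C i *m psi i).
  by rewrite /psi /=; case: boolp.cid => /= x [].
have psiE i : mxsupp (fun m => mdeg m = if i is 0 then e else 1%N) (psi i).
  by case: (svalP (Psi i)).
clearbody psi; clear Psi step good0 good.
pose s i := (rk r i.+1 + rk c i)%N.
pose D i : 'M_(rk s i.+1, rk s i) :=
  match i return 'M_(rk s i.+1, rk s i) with
  | 0%N => col_mx (A 0%N) (psi 0%N)
  | j.+1 => block_mx (A j.+1) 0 (psi j.+1) (C j)
  end.
exists s, D; split; first split.
- by move=> i j; rewrite /D mxE; case: splitP => k _; [apply: A0|apply: psiE].
- move=> i k l; rewrite /D mxE; case: splitP => k' _; rewrite mxE.
    case: splitP => l' _; first exact: AS.
    by rewrite mxE; apply: psupp0.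
  case: splitP => l' _; first exact: psiE.
  by case: (i) k' l' => [|?] k' l'; [apply: C0 | apply: CS].
- case=> [|i]; rewrite /D.
    by rewrite mul_block_col mul0mx addr0 AA psiS addNr col_mx0.
  by rewrite mulmx_block !mul0mx !mulmx0 !addr0 add0r AA psiS CC addNr block_mx0.
- move=> f; split=> [[g [h [/AI[w ->] ->]]]|[w ->]].
    exists (row_mx w h%:M); rewrite /D mul_row_col psi0 [RHS]mxE; congr (_ + _).
    by rewrite mul_mx_scalar !mxE mulrC.
  rewrite -[w]hsubmxK /D mul_row_col psi0 mxE.
  exists ((lsubmx w *m A 0%N) ord0 ord0), (rsubmx w ord0 ord0).
  split; first by apply/AI; exists (lsubmx w).
  by rewrite mul_mx_scalar [X in _ + X]mxE mulrC.
move=> i v; rewrite -[v]hsubmxK; move: (lsubmx v) (rsubmx v) => {v} a b vD.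
(* The second component of a cycle is a boundary of [C]. For [i = 0] the cycle equation puts [b * p]
   in [I], so [b] is in the colon ideal [J]. *)
have [x xE] : exists x, b = x *m C i.
  case: i a b vD => [|i] a b; rewrite /D; last first.
    rewrite mul_row_block mulmx0 add0r -row_mx0 => /eq_row_mx[_ /exC//].
  rewrite mul_row_col psi0 mul_mx_scalar => E.
  have /CJ[x xE] : J (b ord0 ord0).
    apply/colon/AI; exists (- a); rewrite mulNmx.
    have/eqP := E; rewrite addr_eq0 => /eqP ->; rewrite opprK mxE mulrC //.
  by exists x; apply/matrixP => k l; rewrite !ord1.
(* Subtracting the boundary of [x] leaves a cycle concentrated in the complex [A]. *)
have [|y yE] := exA i (a - x *m psi i.+1).
  rewrite mulmxBl -mulmxA psiS mulmxN opprK mulmxA -xE.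
  case: i a b vD x xE => [|i] a b; rewrite /D; first by rewrite mul_row_col.
  by rewrite mul_row_block -row_mx0 => /eq_row_mx[].
exists (row_mx y x); rewrite /D mul_row_block mulmx0 add0r -xE -yE.
by rewrite subrK.
Qed.
End LinearResolutions.

(** * Linear quotients *)

Section LinearQuotients.
Variables (n : nat) (K : fieldType).
Implicit Types (m u v : 'X_{1..n}) (s : seq 'X_{1..n}).

Lemma psupp_mulX (P : 'X_{1..n} -> Prop) (f : {mpoly K[n]}) u :
  psupp (fun m => P (m + u)%MM) f <-> psupp P (f * 'X_[u]).
Proof.
split=> Pf m.
  by rewrite (perm_mem (msuppMX f u)) => /mapP[k /Pf + ->]; rewrite addmC.
by move=> mf; apply: Pf; rewrite (perm_mem (msuppMX f u)) addmC map_f.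
Qed.

Lemma psupp_addX (P Q : pred 'X_{1..n}) u (f : {mpoly K[n]}) :
  (forall m, Q m = P m || (u <= m)%MM) ->
  psupp Q f <-> exists g h, psupp P g /\ f = g + h * 'X_[u].
Proof.
move=> QE; split=> [Qf|[g [h [Pg ->]]]]; last first.
  apply: psuppD; first by apply: psuppS Pg => m; rewrite QE => ->.
  apply/psupp_mulX => m _; by rewrite QE lem_addl orbT.
exists (mproj P f), (\sum_(m <- msupp f | ~~ P m) f@_m *: 'X_[m - u]); split.
  by apply: psuppS (psupp_mproj (P := P) Qf) => m [].
rewrite {1}[f]mpolyE (bigID P) /=; congr (_ + _).
rewrite mulr_suml [LHS]big_seq_cond [RHS]big_seq_cond.
apply: eq_bigr => m /andP[/Qf + nPm]; rewrite QE (negbTE nPm) /= => um.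
by rewrite -scalerAl -mpolyXD submK.
Qed.

Definition divisible_by s m := has (fun v => v <= m)%MM s.

(** The zero ideal counts as resolved in every degree, which starts the inductions below. *)
Lemma linearly_resolved0 e :
  linearly_resolved (psupp (fun=> False) : {mpoly K[n]} -> Prop) e.
Proof.
exists (fun=> 0%N), (fun=> 0); split; first split.
- by move=> i j; rewrite mxE; apply: psupp0.
- by move=> i k l; rewrite mxE; apply: psupp0.
- by move=> i; rewrite mul0mx.
- move=> f; split=> [f0|[w ->]]; last by rewrite mulmx0 mxE; apply: psupp0.
  exists 0; rewrite mulmx0 mxE; apply: msuppnil0.
  by case E: (msupp f) => [//|m t]; case: (f0 m); rewrite E mem_head.
- move=> i v _; exists 0; rewrite mul0mx; apply/matrixP=> k [l //].
Qed.

(** The cone over multiplication by ['X_[u]]; [J] is the colon ideal of [P] by [u]. *)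
Lemma linearly_resolved_add_monomial (P Q J : pred 'X_{1..n}) u :
  linearly_resolved (psupp P : {mpoly K[n]} -> Prop) (mdeg u) ->
  linearly_resolved (psupp J : {mpoly K[n]} -> Prop) 1 ->
  (forall m, J m = P (m + u)%MM) ->
  (forall m, Q m = P m || (u <= m)%MM) ->
  linearly_resolved (psupp Q : {mpoly K[n]} -> Prop) (mdeg u).
Proof.
move=> LP LJ JE QE.
have := @linearly_resolved_cone _ _ _ _ _ 'X_[u] LP LJ.
rewrite dhomogX eqxx => /(_ isT) cone.
apply: linearly_resolved_ext (cone _) => f; first by symmetry; apply: psupp_addX.
by rewrite -psupp_mulX; split; apply: psuppS => m; rewrite JE.
Qed.

(** Variables are added one at a time: the colon of an ideal of variables by a new variable is that
    ideal again. *)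
Lemma linearly_resolved_variables (t : seq 'I_n) :
  linearly_resolved
    (psupp (fun m => has (fun j => m j != 0%N) t) : {mpoly K[n]} -> Prop) 1.
Proof.
elim: t => [|k t IH].
  by apply: linearly_resolved_ext (linearly_resolved0 1) => f; split; apply: psuppS.
have [kt|kt] := boolP (k \in t).
  apply: linearly_resolved_ext IH => f; split; apply: psuppS => m /=.
    by move->; rewrite orbT.
  by case/orP=> // mk; apply/hasP; exists k.
rewrite -(mdeg1 k); apply: linearly_resolved_add_monomial.
- by rewrite mdeg1; apply: IH.
- exact: IH.
- move=> m; apply: eq_in_has => j jt; rewrite mnmDE mnm1E.
  by case: (k =P j) kt => [->|_ _]; rewrite ?jt // addn0.
- by move=> m /=; rewrite orbC lep1mP.
Qed.

Lemma linear_quotients_resolved s e :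
  all (fun m => mdeg m == e) s ->
  (forall s1 u s2, s = s1 ++ u :: s2 -> exists t : seq 'I_n, forall m,
     divisible_by s1 (m + u)%MM = has (fun j => m j != 0%N) t) ->
  linearly_resolved (psupp (divisible_by s) : {mpoly K[n]} -> Prop) e.
Proof.
elim/last_ind: s => [_ _|s u IH].
  by apply: linearly_resolved_ext (linearly_resolved0 e) => f; split; apply: psuppS.
rewrite all_rcons => /andP[/eqP ue se] quot.
have [t tE] := quot s u [::] (esym (cats1 _ _)).
rewrite -ue; apply: linearly_resolved_add_monomial.
- rewrite ue; apply: IH => // s1 u' s2 sE.
  by apply: (quot s1 u' (rcons s2 u)); rewrite sE rcons_cat.
- exact: (linearly_resolved_variables t).
- by move=> m; rewrite tE.
- by move=> m; rewrite /divisible_by -cats1 has_cat /= orbF.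
Qed.

(* Listed in increasing lexicographic order, a set with the exchange property
   has linear quotients. *)
Lemma exchange_resolved (B : 'X_{1..n} -> Prop) e :
  (forall u, B u -> mdeg u = e) ->
  (forall u v, B u -> B v -> forall i, (v i < u i)%N ->
     exists2 j, (u j < v j)%N & B ((u - U_(i)) + U_(j))%MM) ->
  linearly_resolved
    (psupp (fun m => exists2 v, B v & (v <= m)%MM) : {mpoly K[n]} -> Prop) e.
Proof.
move=> Be exB.
pose s0 :=
  [seq bmnm x | x <- enum [pred x : 'X_{1..n < e.+1} | boolp.asbool (B (bmnm x))]].
pose s : seq 'X_{1..n} := sort <=%O s0.
have sP m : m \in s <-> B m.
  rewrite mem_sort; split=> [/mapP[x]|Bm].
    by rewrite mem_enum => /boolp.asboolP Bx ->.
  have me : (mdeg m < e.+1)%N by rewrite (Be m Bm).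
  by apply/mapP; exists (BMultinom me); rewrite // mem_enum; apply/boolp.asboolP.
have s_lt : sorted <%O s.
  rewrite sort_lt_sorted map_inj_uniq ?enum_uniq //; exact: val_inj.
apply: linearly_resolved_ext (@linear_quotients_resolved s e _ _)
  => [f||s1 u s2 sE].
- split; apply: psuppS => m.
    by case/hasP=> v /sP Bv vm; exists v.
  by case=> v /sP vs vm; apply/hasP; exists v.
- by apply/allP => m /sP /Be ->.
- have Bu : B u by apply/sP; rewrite sE mem_cat mem_head orbT.
  have s1P m : m \in s1 <-> B m /\ (m < u)%O.
    move: s_lt; rewrite sE lt_sorted_pairwise pairwise_cat /=.
    move=> /and3P[/allrelP s1_lt _ /andP[/allP s2_gt _]].
    split=> [ms|[/sP + mu]].
      by split; [apply/sP; rewrite sE mem_cat ms | apply: s1_lt; rewrite ?mem_head].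
    rewrite sE mem_cat in_cons => /or3P[//|/eqP E|/s2_gt um].
      by rewrite E ltxx in mu.
    by have := lt_trans mu um; rewrite ltxx.
  (* The colon ideal is generated by the variables [j] for which an earlier generator divides
     [u + U_(j)]. *)
  exists (enum [pred j | has (fun v => v <= u + U_(j))%MM s1]) => m.
  apply/idP/idP => [/hasP[v /s1P[Bv vu] vm]|/hasP[j]]; last first.
    rewrite mem_enum => /hasP[v vs vu] mj; apply/hasP; exists v => //.
    apply: lepm_trans vu _; rewrite addmC; apply/mnm_lepP => l.
    by rewrite !mnmDE leq_add2r mnm1E; case: (j =P l) mj => [<-|//]; rewrite lt0n.
  (* [i] is the first place where [v] and [u] differ. Exchanging there gives [j] after [i], so the
     new generator precedes [u] and divides [u + U_(j)]; [j] occurs in [m] because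
     [u j < v j <= m j + u j]. *)
  have /(ltmcP (etrans (Be v Bv) (esym (Be u Bu))))[i eqi lti] := vu.
  have [j ltj Bw] := exB _ _ Bu Bv _ lti.
  have ij : (i < j)%N.
    rewrite ltnNge leq_eqVlt; apply/negP => /orP[/eqP/val_inj E|/eqi E].
      by move: ltj; rewrite E ltnNge (ltnW lti).
    by rewrite E ltnn in ltj.
  apply/hasP; exists j; last first.
    move/mnm_lepP: vm => /(_ j); rewrite mnmDE => vm.
    by rewrite -lt0n -(ltn_add2r (u j)) add0n (leq_trans ltj vm).
  rewrite mem_enum; apply/hasP; exists (u - U_(i) + U_(j))%MM; last first.
    by apply/mnm_lepP => l; rewrite !mnmDE mnmBE leq_add2r leq_subr.
  apply/s1P; split=> //; apply/ltmcP; first by rewrite (Be _ Bw) (Be _ Bu).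
  exists i => [l li|]; rewrite mnmDE mnmBE !mnm1E.
    by rewrite -!val_eqE /= (gtn_eqF li) (gtn_eqF (ltn_trans li ij)) subn0 addn0.
  rewrite eqxx -val_eqE /= (gtn_eqF ij) addn0 subn1 prednK ?leqnn //.
  exact: leq_ltn_trans lti.
Qed.

End LinearQuotients.

(** * Monomial ideals *)

Section MonomialIdealTheory.
Variables (n : nat) (K : fieldType).
Implicit Types (I J : {mpoly K[n]} -> Prop) (m u v : 'X_{1..n}).
Implicit Types (B M : 'X_{1..n} -> Prop).

Lemma mono_genP M (f : {mpoly K[n]}) :
  mono_gen M f <-> psupp (fun m => exists2 v, M v & (v <= m)%MM) f.
Proof.
split=> [[s [sM ->]]|Mf].
  rewrite big_seq; apply: big_ind => [||c /sM[v Mv ->]].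
  - exact: psupp0.
  - exact: psuppD.
  - apply: (@psuppM _ _ (fun=> True) (fun m => m = v)) => //.
      by move=> a b _ ->; exists v => //; rewrite lem_addl.
    exact: psuppX.
have /boolp.choice[v vP] m : exists v, m \in msupp f -> M v /\ (v <= m)%MM.
  have [/Mf[v Mv vm]|] := boolP (m \in msupp f); first by exists v.
  by exists 0%MM.
exists [seq (f@_m *: 'X_[m - v m], 'X_[v m]) | m <- msupp f]; split.
  by move=> c /mapP[m /vP[Mv _] ->] /=; exists (v m).
rewrite big_map /= {1}[f]mpolyE big_seq [RHS]big_seq.
apply: eq_bigr => m /vP[_ vm]; by rewrite -scalerAl -mpolyXD submK.
Qed.

Lemma monomial_ideal_up I u v :
  monomial_ideal I -> (u <= v)%MM -> I 'X_[u] -> I 'X_[v].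
Proof.
move=> [M IM] uv /IM/mono_genP/(iffLR (psuppXP _ _ _))[w Mw wu].
by apply/IM/mono_genP; apply: psuppX; exists w => //; apply: lepm_trans uv.
Qed.

Lemma monomial_idealP I :
  monomial_ideal I -> forall f, I f <-> psupp (fun m => I 'X_[m]) f.
Proof.
move=> [M IM] f; rewrite IM mono_genP; split; apply: psuppS => m.
  by move=> Mm; apply/IM/mono_genP; apply: psuppX.
by move/IM/mono_genP/(iffLR (psuppXP _ _ _)).
Qed.

Lemma mono_gen_mem M m : mono_gen M ('X_[m] : {mpoly K[n]}) <->
  exists2 v, M v & (v <= m)%MM.
Proof. by rewrite mono_genP psuppXP. Qed.

Lemma same_mono_gen I M : monomial_ideal I ->
  (forall m, I 'X_[m] <-> exists2 v, M v & (v <= m)%MM) ->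
  same_ideal I (mono_gen M).
Proof.
move=> mI IM f; rewrite (monomial_idealP mI) mono_genP.
by split; apply: psuppS => m /IM.
Qed.

Definition minimal_monomial I m :=
  I 'X_[m] /\ forall v, (v <= m)%MM -> I 'X_[v] -> v = m.

Lemma lem_neq_mdeg u v : (u <= v)%MM -> u <> v -> (mdeg u < mdeg v)%N.
Proof.
move=> uv nuv; rewrite -(submK uv) mdegD -[X in (X < _)%N]add0n ltn_add2r.
rewrite lt0n mdeg_eq0; apply: contra_notN nuv => /eqP E.
by rewrite -(submK uv) E add0m.
Qed.

Lemma minimal_monomial_below I m :
  I 'X_[m] -> exists2 v, minimal_monomial I v & (v <= m)%MM.
Proof.
have [k] := ubnP (mdeg m); elim: k m => // k IH m mk Im.
have [mm|] := boolp.EM (minimal_monomial I m).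
  by exists m => //; apply: lepm_refl.
move=> nm; have [v [vm Iv nvm]] : exists v, [/\ (v <= m)%MM, I 'X_[v] & v <> m].
  apply: boolp.contra_notP nm => nv; split=> // v vm Iv.
  by apply: boolp.contrapT => nvm; apply: nv; exists v.
have [|w mw wv] := IH v _ Iv.
  exact: leq_trans (lem_neq_mdeg vm nvm) _.
by exists w => //; apply: lepm_trans vm.
Qed.

(** A generator with a proper divisor in [I] could be dropped from a minimal generating set;
    conversely, every generating set contains the monomials minimal for divisibility. *)
Lemma mingensP I m : monomial_ideal I -> mingens I m <-> minimal_monomial I m.
Proof.
move=> mI; split=> [[M [IM minM] Mm]|mm].
  have Imem v : I 'X_[v] <-> exists2 w, M w & (w <= v)%MM.
    by rewrite IM mono_gen_mem.
  split; first by apply/Imem; exists m => //; apply: lepm_refl.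
  move=> v vm Iv; apply: boolp.contrapT => nvm.
  suff sg : same_ideal I (mono_gen (fun w => M w /\ w <> m)).
    by case: (minM _ (fun w => @proj1 _ _) sg m Mm).
  apply: same_mono_gen => // w; split=> [|[x [Mx _] xw]]; last by apply/Imem; exists x.
  move=> /Imem[x Mx xw]; have [E|nx] := boolp.EM (x = m); last by exists x.
  have /Imem[y My yv] := Iv; exists y; last first.
    by apply: lepm_trans xw; rewrite E; apply: lepm_trans vm.
  split=> // E'; apply: nvm; have := lem_neq_mdeg vm.
  rewrite -E' => L; apply: boolp.contrapT => /L; apply/negP; rewrite -leqNgt.
  by rewrite -(submK yv) mdegD leq_addl.
exists (minimal_monomial I) => //; split.
  apply: same_mono_gen => // v; split; first exact: minimal_monomial_below.
  by case=> w [Iw _] wv; apply: monomial_ideal_up Iw.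
move=> M' sub IM' v [Iv vmin]; have /IM'/mono_gen_mem[w Mw wv] := Iv.
by rewrite -(vmin w) //; case: (sub _ Mw).
Qed.

Section GeneratedInDegree.
Variables (I : {mpoly K[n]} -> Prop) (e : nat).
Hypotheses (mI : monomial_ideal I) (Ie : generated_in_degree I e).

Lemma mingens_below m : I 'X_[m] -> exists2 v, mingens I v & (v <= m)%MM.
Proof.
by case/minimal_monomial_below => v mv vm; exists v => //; apply/mingensP.
Qed.

Lemma degree_lower_bound m : I 'X_[m] -> (e <= mdeg m)%N.
Proof.
case/mingens_below=> v /Ie.2 <- vm.
by rewrite -(submK vm) mdegD leq_addl.
Qed.

Lemma mingens_of_degree m : mdeg m = e -> (mingens I m <-> I 'X_[m]).
Proof.
move=> me; split=> [/mingensP[]//|Im]; apply/mingensP => //; split=> // v vm Iv.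
apply: boolp.contrapT => /(lem_neq_mdeg vm); rewrite me ltnNge.
by rewrite degree_lower_bound.
Qed.

(** For [S = set0] the congruences of [socle_modulo] are equalities, and the image of [D 0] is
    [I]. *)
Lemma socle_degree m : linearly_resolved I e -> (e <= mdeg m)%N ->
  (forall k, I 'X_[m + U_(k)]) -> I 'X_[m].
Proof.
move=> [r [D [linD DI exD]]] em socm.
(* A generator of degree [0] is [1], so [I] is then the unit ideal; [socle_modulo] covers positive
   [e]. *)
have [e0|e_gt0] := posnP e.
  have [[v mv] ve] := Ie; have /mingensP[//|Iv _] := mv.
  apply: monomial_ideal_up Iv => //.
  have /eqP := ve v mv; rewrite e0 mdeg_eq0 => /eqP ->.
  by apply/mnm_lepP => i; rewrite mnm0E.
have set0P a b (A : 'M[{mpoly K[n]}]_(a, b)) : mxsupp (meets set0) A -> A = 0.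
  by apply: mxsupp_eq0 => k [i]; rewrite inE.
have [|||w] := socle_modulo (S := set0) (g := ('X_[m])%:M) e_gt0 linD.
- move=> i v /set0P/exD[w ->]; exists w; rewrite subrr; exact: mxsupp0.
- by move=> i j; rewrite !ord1 mxE eqxx; apply: psuppX.
- move=> k _; have /DI[w wE] := socm k; exists w.
  rewrite (_ : _ - _ = 0); first exact: mxsupp0.
  apply/eqP; rewrite subr_eq0; apply/eqP/matrixP => i j.
  by rewrite !ord1 -wE !mxE eqxx mpolyXD mulrC.
move=> /set0P/eqP; rewrite subr_eq0 => /eqP gE; apply/DI; exists w.
by rewrite -gE mxE eqxx.
Qed.

End GeneratedInDegree.

Lemma exchange_has_linear_resolution I B e :
  (exists u, B u) -> (forall u, B u -> mdeg u = e) ->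
  (forall u v, B u -> B v -> forall i, (v i < u i)%N ->
     exists2 j, (u j < v j)%N & B ((u - U_(i)) + U_(j))%MM) ->
  (forall f, I f <-> psupp (fun m => exists2 v, B v & (v <= m)%MM) f) ->
  has_linear_resolution I.
Proof.
move=> [u0 Bu0] Be exB IB; apply/has_linear_resolutionP; exists e; last first.
  by apply: linearly_resolved_ext (exchange_resolved K Be exB) => f; rewrite IB.
have Imem m : I 'X_[m] <-> exists2 v, B v & (v <= m)%MM.
  by rewrite IB psuppXP.
have mI : monomial_ideal I by exists B => f; rewrite IB mono_genP.
have minB m : mingens I m -> B m.
  move=> /(mingensP _ mI)[/Imem[v Bv vm] mmin].
  by rewrite -(mmin v) //; apply/Imem; exists v => //; apply: lepm_refl.
split=> [|m /minB/Be//].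
have [|v mv _] := @mingens_below I mI u0; last by exists v.
by apply/Imem; exists u0 => //; apply: lepm_refl.
Qed.

End MonomialIdealTheory.

(** * Weights and tight sets *)

Section Weight.
Variable n : nat.
Implicit Types (A B : {set 'I_n}) (u v : 'X_{1..n}).
Local Open Scope nat_scope.

Definition wt A u := \sum_(i in A) u i.

Lemma wtT u : wt setT u = mdeg u.
Proof. by rewrite mdegE; apply: eq_bigl => i; rewrite inE. Qed.

Lemma wtD A u v : wt A (u + v)%MM = wt A u + wt A v.
Proof. by rewrite /wt -big_split; apply: eq_bigr => i _; rewrite mnmDE. Qed.

Lemma wt1 A i : wt A U_(i)%MM = (i \in A).
Proof.
have [iA|iA] := boolP (i \in A).
  rewrite /wt (bigD1 i) //= mnm1E eqxx big1 ?addn0 // => j /andP[_ ji].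
  by rewrite mnm1E eq_sym (negbTE ji).
rewrite /wt big1 // => j jA; rewrite mnm1E; case: eqP jA iA => // -> ->//.
Qed.

Lemma wt_exchange A u i j : 0 < u i ->
  wt A (u - U_(i) + U_(j))%MM + (i \in A) = wt A u + (j \in A).
Proof.
move=> ui; have {2}-> : u = (u - U_(i) + U_(i))%MM.
  by rewrite submK // lep1mP -lt0n.
by rewrite !wtD !wt1 addnAC.
Qed.

Lemma leq_wt A u v : (forall i, i \in A -> u i <= v i) -> wt A u <= wt A v.
Proof. by move=> uv; apply: leq_sum => i /uv. Qed.

Lemma wtUI A B u : wt A u + wt B u = wt (A :|: B) u + wt (A :&: B) u.
Proof.
have E C : wt C u = \sum_i if i \in C then u i else 0 by apply: big_mkcond.
rewrite !E -!big_split /=; apply: eq_bigr => i _; rewrite !inE.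
by case: (i \in A); case: (i \in B); rewrite ?addn0.
Qed.

Lemma wtC A u : wt A u + wt (~: A) u = mdeg u.
Proof. by rewrite wtUI setUCr setICr wtT /wt big_set0 addn0. Qed.

End Weight.

(* [P] is the set of exponents of a monomial ideal [I] and [f A] the degree of
   the generators of its localization at [A]. *)
Section LocalSocles.
Variables (n : nat) (P : 'X_{1..n} -> Prop) (f : {set 'I_n} -> nat).
Implicit Types (A B : {set 'I_n}) (u v : 'X_{1..n}) (i j k : 'I_n).
Local Open Scope nat_scope.

(** Membership of the monomial [u] in the localization at [A], where exponents outside [A] are
    ignored. *)
Definition locally A u := exists2 v, P v & forall i, i \in A -> v i <= u i.

Hypothesis P_up : forall u v, (u <= v)%MM -> P u -> P v.
Hypothesis f_min : forall A v, P v -> f A <= wt A v.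
Hypothesis f_attained : forall A u, locally A u ->
  exists v, [/\ P v, forall i, i \in A -> v i <= u i & wt A v = f A].
Hypothesis f_socle : forall A u, f A <= wt A u ->
  (forall i, i \in A -> locally A (u + U_(i))%MM) -> locally A u.

Lemma locally_wt A u : (forall B, B \subset A -> f B <= wt B u) -> locally A u.
Proof.
have [k] := ubnP #|A|; elim: k A => // k IH A Ak fu.
(* The induction hypothesis at [A :\ i] gives [V i], which fits under [u] on [A] except perhaps at
   [i]. *)
have /boolp.choice[V VP] i : exists v, i \in A ->
    P v /\ forall j, j \in A -> j != i -> v j <= u j.
  have [iA|] := boolP (i \in A); last by exists u.
  have [||v Pv vu] := IH (A :\ i).
  - by rewrite (cardsD1 i A) iA in Ak.
  - by move=> B BA; apply: fu; apply: subset_trans BA (subsetDl _ _).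
  by exists v => _; split=> // j jA ji; apply: vu; rewrite !inE ji.
suff main : forall u', (u <= u')%MM -> locally A u' by apply: main; apply: lepm_refl.
(* Induction on the total amount by which the [u' i] fall short of [V i i]. Once some [V i] fits
   under [u'] the claim holds; otherwise every step up in [A] is settled by induction, and [f_socle]
   comes back down. *)
move=> u'; have [N] := ubnP (\sum_(i in A) (V i i - u' i)).
elim: N u' => // N IHN u' ltN /mnm_lepP uu'.
have [[i iA Vi]|no] := boolp.EM (exists2 i, i \in A & V i i <= u' i).
  have [PV Vu] := VP i iA; exists (V i) => // j jA.
  by have [->//|ji] := eqVneq j i; apply: leq_trans (uu' j); apply: Vu.
apply: f_socle => [|i iA].
  by apply: leq_trans (fu A (subxx _)) _; apply: leq_wt.
have lti : u' i < V i i.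
  by rewrite ltnNge; apply/negP => ?; apply: no; exists i.
apply: IHN; last by apply/mnm_lepP => j; rewrite mnmDE (leq_trans (uu' j)) ?leq_addr.
rewrite ltnS in ltN; apply: leq_trans ltN.
rewrite (bigD1 i) //= [X in _ < X](bigD1 i) //= -addSn leq_add //.
  by rewrite mnmDE mnm1E eqxx; lia.
by apply: leq_sum => j _; rewrite mnmDE; lia.
Qed.

(** Tightness forces equality in [f A + f B <= f (A :|: B) + f (A :&: B)], since [f] bounds the
    weights of [u] on union and intersection from below. *)
Lemma tight_cap u A B : P u -> wt A u = f A -> wt B u = f B ->
  wt (A :&: B) u = f (A :&: B).
Proof.
move=> Pu uA uB; have loc C v : P v -> locally C v by exists v.
(* [w] will weigh [f (A :|: B)] on the union and at most [f (A :&: B)] on the intersection, staying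
   below [v] there. *)
have [v [Pv _ vI]] := f_attained (loc (A :&: B) u Pu).
have [w [Pw wv wU]] := f_attained (loc (A :|: B) v Pv).
have := f_min A Pw; have := f_min B Pw; have := f_min (A :&: B) Pu.
have := f_min (A :|: B) Pu; have := wtUI A B u; have := wtUI A B w.
have : wt (A :&: B) w <= wt (A :&: B) v.
  by apply: leq_wt => i; rewrite inE => /andP[iA _]; apply: wv; rewrite inE iA.
lia.
Qed.

(** The index [j] is found in a smallest tight set [T] containing [i]. A set [B] obstructing the
    exchange would be tight and contain [i] but not [j], making [T :&: B] a smaller such set. *)
Lemma local_exchange u v i : P u -> P v -> wt setT u = f setT -> v i < u i ->
  exists2 j, u j < v j & P (u - U_(i) + U_(j))%MM.
Proof.
move=> Pu Pv uT vu.
pose tight (T : {set 'I_n}) := (i \in T) && (wt T u == f T).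
have tightT : tight setT by rewrite /tight inE uT eqxx.
case: (arg_minnP (fun T : {set 'I_n} => #|T|) tightT) => T /andP[iT /eqP uTT] minT.
(* Without such a [j], [v] would weigh less than [f T] on [T]. *)
have [[j jT uv]|no] := boolp.EM (exists2 j, j \in T & u j < v j); last first.
  have := f_min T Pv; rewrite -uTT leqNgt => /negP[].
  rewrite /wt (bigD1 i) //= [X in _ < X](bigD1 i) //= -addSn leq_add //.
  apply: leq_sum => j /andP[jT _]; rewrite leqNgt; apply/negP => uv.
  by apply: no; exists j.
exists j => //; set w := (_ + _)%MM.
have u_gt0 : 0 < u i by apply: leq_ltn_trans vu.
have [v0 Pv0 v0w] : locally setT w.
  apply: locally_wt => B _; rewrite leqNgt; apply/negP => wB.
  have := wt_exchange B j u_gt0; have := f_min B Pu; rewrite -/w => fB wE.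
  have [iB jB uB] : [/\ i \in B, j \notin B & wt B u = f B].
    by move: wE; case: (i \in B); case: (j \in B) => /=; split=> //; lia.
  have : tight (T :&: B).
    by rewrite /tight inE iT iB (tight_cap Pu uTT uB) eqxx.
  move/minT; rewrite leqNgt => /negP[]; apply: proper_card.
  by apply/properP; split; [apply: subsetIl | exists j; rewrite // inE jT].
by apply: P_up Pv0; apply/mnm_lepP => k; apply: v0w; rewrite inE.
Qed.

End LocalSocles.

(** * Monomial localization *)

(** Indexed by the set of variables instead of the prime, so that the type of the result depends on
    [A] alone. *)
Definition localize n (K : fieldType) (I : {mpoly K[n]} -> Prop)
    (A : {set 'I_n}) : {mpoly K[#|A|]} -> Prop :=
  fun g => exists2 f, I f & g = set_vars_to_one A f.
Arguments localize {n K} I A _.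

Section Localization.
Variables (n : nat) (K : fieldType).
Implicit Types (I : {mpoly K[n]} -> Prop) (A : {set 'I_n}) (u v : 'X_{1..n}).

Definition restr A u : 'X_{1..#|A|} := [multinom u (enum_val j) | j < #|A|].

Lemma restrE A u j : restr A u j = u (enum_val j).
Proof. exact: mnmE. Qed.

Lemma restrD A u v : restr A (u + v) = (restr A u + restr A v)%MM.
Proof. by apply/mnmP => j; rewrite mnmDE !restrE mnmDE. Qed.

Lemma restr1 A (j : 'I_#|A|) : restr A U_(enum_val j) = U_(j)%MM.
Proof. by apply/mnmP => k; rewrite restrE !mnm1E (inj_eq enum_val_inj). Qed.

Lemma mdeg_restr A u : mdeg (restr A u) = wt A u.
Proof. by rewrite mdegE /wt [RHS]big_enum_val; apply: eq_bigr => j _; rewrite restrE. Qed.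

Lemma restr_le A u v : (restr A u <= restr A v)%MM <->
  forall i, i \in A -> (u i <= v i)%N.
Proof.
split=> [/mnm_lepP uv i iA|uv].
  by have := uv (enum_rank_in iA i); rewrite !restrE enum_rankK_in.
by apply/mnm_lepP => j; rewrite !restrE; apply/uv/enum_valP.
Qed.

Lemma restr_surj A u (m : 'X_{1..#|A|}) : (restr A u <= m)%MM ->
  exists2 v, (u <= v)%MM & restr A v = m.
Proof.
move=> /mnm_lepP um.
(* Off [A] the preimage keeps the exponents of [u]. *)
exists [multinom oapp m (u i) [pick j : 'I_#|A| | enum_val j == i] | i < n].
  apply/mnm_lepP => i; rewrite mnmE; case: pickP => //= j /eqP <-.
  by rewrite -restrE.
apply/mnmP => j; rewrite restrE mnmE; case: pickP => [k /eqP/enum_val_inj ->//|].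
by move/(_ j); rewrite eqxx.
Qed.

Lemma set_vars_to_oneX A u :
  set_vars_to_one A 'X_[K, u] = 'X_[restr A u].
Proof.
rewrite /set_vars_to_one comp_mpolyX mpolyXE_id (bigID (mem A)) /=.
rewrite [X in _ * X]big1 ?mulr1 => [|i iA]; last first.
  rewrite tnth_mktuple; case: pickP => [j /eqP E|_]; last exact: expr1n.
  by rewrite -E enum_valP in iA.
rewrite big_enum_val; apply: eq_bigr => j _; rewrite tnth_mktuple restrE.
case: pickP => [k /eqP/enum_val_inj ->//|/(_ j)]; by rewrite eqxx.
Qed.

Lemma set_vars_to_one_sum A (T : Type) (r : seq T) (c : T -> K)
    (F : T -> 'X_{1..n}) :
  set_vars_to_one A (\sum_(t <- r) c t *: 'X_[F t]) =
  \sum_(t <- r) c t *: 'X_[restr A (F t)].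
Proof.
rewrite /set_vars_to_one raddf_sum; apply: eq_bigr => t _.
by rewrite /= comp_mpolyZ -/(set_vars_to_one A 'X_[F t]) set_vars_to_oneX.
Qed.

(** The substitution sends monomials to monomials; conversely a polynomial is lifted term by term,
    with a chosen preimage in [I] for each monomial. *)
Lemma localizeP I A g : monomial_ideal I ->
  localize I A g <-> psupp (fun m => exists2 u, I 'X_[u] & restr A u = m) g.
Proof.
move=> mI; split=> [[f /(monomial_idealP mI) If ->]|gI].
  rewrite {1}[f]mpolyE set_vars_to_one_sum big_seq.
  apply: big_ind => [||u /If Iu]; [exact: psupp0 | exact: psuppD|].
  rewrite -mul_mpolyC.
  apply: (@psuppM _ _ (fun m => m = 0%MM) (fun m => m = restr A u)).
  - by move=> _ _ -> ->; exists u; rewrite ?add0m.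
  - by move=> m; rewrite msuppC; case: ifP => //; rewrite inE => _ /eqP.
  - exact: psuppX.
have /boolp.choice[w wP] m : exists u, m \in msupp g -> I 'X_[u] /\ restr A u = m.
  have [/gI[u Iu um]|] := boolP (m \in msupp g); first by exists u.
  by exists 0%MM.
exists (\sum_(m <- msupp g) g@_m *: 'X_[w m]).
  apply/(monomial_idealP mI); rewrite big_seq.
  apply: big_ind => [||m /wP[Iw _]]; [exact: psupp0 | exact: psuppD|].
  rewrite -mul_mpolyC.
  apply: (@psuppM _ _ (fun m => m = 0%MM) (fun m' => m' = w m)).
  - by move=> _ _ -> ->; rewrite add0m.
  - by move=> k; rewrite msuppC; case: ifP => //; rewrite inE => _ /eqP.
  - exact: psuppX.
rewrite {1}[g]mpolyE set_vars_to_one_sum big_seq [RHS]big_seq.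
by apply: eq_bigr => m /wP[_ ->].
Qed.

Lemma localizeX I A u : monomial_ideal I ->
  localize I A 'X_[restr A u] <-> locally (fun v => I 'X_[v]) A u.
Proof.
move=> mI; rewrite localizeP // psuppXP; split=> [[v Iv vu]|[v Iv]].
  by exists v => //; apply/restr_le; rewrite vu lepm_refl.
move/restr_le/restr_surj=> [w vw wu]; exists w => //.
exact: monomial_ideal_up Iv.
Qed.

Lemma monomial_localize I A : monomial_ideal I -> monomial_ideal (localize I A).
Proof.
move=> mI; exists (fun m => exists2 u, I 'X_[u] & restr A u = m) => g.
rewrite localizeP // mono_genP; split; apply: psuppS => m.
  by exists m => //; apply: lepm_refl.
case=> _ [u Iu <-] /restr_surj[v uv vm]; exists v => //.
exact: monomial_ideal_up Iu.
Qed.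

Lemma exists_monomial_prime A :
  exists2 p : {mpoly K[n]} -> Prop, monomial_prime p & prime_vars p = A.
Proof.
exists (ideal_gen (fun g => exists2 i, i \in A & g = 'X_i)); first by exists A.
have genE f : ideal_gen (fun g => exists2 i, i \in A & g = 'X_i) f <->
    mono_gen (fun m => exists2 i, i \in A & m = U_(i)%MM) f.
  split=> -[s [sP ->]]; exists s; split=> // c /sP.
    by case=> i iA ->; exists U_(i)%MM => //; exists i.
  by case=> _ [i iA ->] ->; exists i.
apply/setP => i; rewrite inE; apply/boolp.asboolP/idP => [|iA]; last first.
  by apply/genE/mono_gen_mem; exists U_(i)%MM; [exists i | exact: lepm_refl].
by move=> /genE/mono_gen_mem[_ [j jA ->]]; rewrite lep1mP mnm1E; case: (i =P j) => [->|].
Qed.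

(** The generators with the greatest weight [a] off [A] restrict to monomials of degree [d - a] on
    [A]. These generate the localization and inherit the exchange property. *)
Lemma polymatroidal_localize I A :
  polymatroidal I -> has_linear_resolution (localize I A).
Proof.
move=> [mI [d Id] exI].
have ge_d := degree_lower_bound mI Id; have G_d := mingens_of_degree mI Id.
pose C := ~: A.
have ex : exists k, boolp.asbool (exists2 u, mingens I u & wt C u = k).
  by case: Id => -[u mu] _; exists (wt C u); apply/boolp.asboolP; exists u.
have bnd k : boolp.asbool (exists2 u, mingens I u & wt C u = k) -> (k <= d)%N.
  move/boolp.asboolP => [u /(Id.2) <- <-].
  by rewrite -(wtC A u) leq_addl.
case: (ex_maxnP ex bnd) => a /boolp.asboolP[u0 mu0 u0a] amax.
have {}amax u : mingens I u -> (wt C u <= a)%N.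
  by move=> mu; apply: amax; apply/boolp.asboolP; exists u.
(* An exchange on a coordinate in [A] keeps the weight on [C] maximal, so the
   coordinate received is in [A] too. *)
have exA u v i : mingens I u -> mingens I v -> wt C u = a -> i \in A ->
    (v i < u i)%N -> exists j, [/\ j \in A, (u j < v j)%N,
      mingens I (u - U_(i) + U_(j))%MM & wt C (u - U_(i) + U_(j))%MM = a].
  move=> mu mv ua iA vu; have [j uv Iw] := exI u v mu mv i vu.
  have ui : (0 < u i)%N by apply: leq_ltn_trans vu.
  have mw : mingens I (u - U_(i) + U_(j))%MM.
    apply/G_d => //; have := wt_exchange setT j ui.
    by rewrite !inE !wtT (Id.2 u mu) => /addIn.
  have := wt_exchange C j ui; have := amax _ mw; rewrite !inE iA ua addn0 /=.
  move=> le E; exists j; move: E; rewrite addnC; case: (j \in A) => /= E.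
    by split=> //; lia.
  by move: le; lia.
pose B b := exists2 u, mingens I u /\ wt C u = a & restr A u = b.
have exB b b' : B b -> B b' -> forall i, (b' i < b i)%N ->
    exists2 j, (b j < b' j)%N & B ((b - U_(i)) + U_(j))%MM.
  move=> [u [mu ua] <-] [v [mv va] <-] i; rewrite !restrE => vu.
  have [j [jA uv mw wa]] := exA u v _ mu mv ua (enum_valP i) vu.
  exists (enum_rank_in jA j); first by rewrite !restrE enum_rankK_in.
  exists (u - U_(enum_val i) + U_(j))%MM => //; apply/mnmP => k.
  rewrite restrE !mnmDE !mnmBE restrE !mnm1E (inj_eq enum_val_inj).
  by rewrite -(inj_eq enum_val_inj (enum_rank_in _ _)) enum_rankK_in.
(* Starting from [u0], exchanges towards [v] on coordinates of [A] lower the excess over [v] on [A]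
   until it vanishes. *)
have below v : mingens I v ->
    exists2 u, mingens I u /\ wt C u = a & (restr A u <= restr A v)%MM.
  move=> mv; suff main N u : (\sum_(i in A) (u i - v i) < N)%N ->
      mingens I u -> wt C u = a ->
      exists2 u, mingens I u /\ wt C u = a & (restr A u <= restr A v)%MM.
    exact: main (leqnn _) mu0 u0a.
  elim: N u => // N IH u ltN mu ua.
  have [uv|/boolp.existsNP[i /boolp.not_implyP[iA vu]]] :=
      boolp.EM (forall i, i \in A -> (u i <= v i)%N).
    by exists u => //; apply/restr_le.
  have {}vu : (v i < u i)%N by rewrite ltnNge; apply/negP.
  have [j [jA uv mw wa]] := exA u v i mu mv ua iA vu.
  apply: IH mw wa; rewrite ltnS in ltN; apply: leq_trans ltN.
  rewrite (bigD1 i) //= [X in (_ < X)%N](bigD1 i) //= -addSn leq_add //.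
    rewrite mnmDE mnmBE !mnm1E eqxx.
    case: (j =P i) uv => [->|_ _]; lia.
  apply: leq_sum => k _; rewrite mnmDE mnmBE !mnm1E.
  by case: (j =P k) uv => [->|_ _]; lia.
apply: (@exchange_has_linear_resolution _ _ _ B (d - a)%N) => //.
- by exists (restr A u0); exists u0.
- move=> _ [u [mu ua] <-]; rewrite mdeg_restr -(Id.2 u mu) -(wtC A u) ua.
  by rewrite addnK.
move=> g; rewrite localizeP //; split; apply: psuppS => m.
  case=> u /(mingens_below mI)[v mv vu] <-; have [w wB wv] := below v mv.
  exists (restr A w); first by exists w.
  apply: lepm_trans wv _; apply/restr_le => i _; exact: (mnm_lepP vu).
case=> _ [u [mu _] <-] /restr_surj[w uw <-]; exists w => //.
apply: monomial_ideal_up uw _ => //.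
by apply/G_d => //; apply: (Id.2).
Qed.

(** With [f A] the generating degree of the localization at [A], linear resolutions provide
    [f_socle], and [local_exchange] applies. *)
Lemma polymatroidal_of_localize I : monomial_ideal I ->
  (exists d, generated_in_degree I d) ->
  (forall A, has_linear_resolution (localize I A)) -> polymatroidal I.
Proof.
move=> mI [d Id] LI; split=> //; first by exists d.
have /boolp.choice[f fP] A : exists e,
    generated_in_degree (localize I A) e /\ linearly_resolved (localize I A) e.
  by have /has_linear_resolutionP[e] := LI A; exists e.
pose P (u : 'X_{1..n}) := I 'X_[u].
have mJ A := monomial_localize A mI.
have P_up u v : (u <= v)%MM -> P u -> P v by apply: monomial_ideal_up.
have f_min A v : P v -> (f A <= wt A v)%N.
  move=> Pv; rewrite -mdeg_restr.
  apply: (degree_lower_bound (mJ A) (fP A).1); apply/localizeX => //.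
  by exists v.
have f_attained A u : locally P A u ->
    exists v, [/\ P v, forall i, i \in A -> (v i <= u i)%N & wt A v = f A].
  move/(localizeX _ _ mI)/(mingens_below (mJ A)) => [w mw wu].
  have /(mingensP _ (mJ A))[+ _] := mw.
  rewrite localizeP // psuppXP => -[v Pv vw]; exists v; split=> //.
    by apply/restr_le; rewrite vw.
  by rewrite -mdeg_restr vw; apply: (fP A).1.2.
have f_socle A u : (f A <= wt A u)%N ->
    (forall i, i \in A -> locally P A (u + U_(i))%MM) -> locally P A u.
  move=> fu loc; apply/(localizeX _ _ mI).
  apply: (socle_degree (mJ A) (fP A).1 (fP A).2); first by rewrite mdeg_restr.
  by move=> k; rewrite -restr1 -restrD; apply/(localizeX _ _ mI)/loc/enum_valP.
move=> u v /(mingensP _ mI)[Iu umin] /(mingensP _ mI)[Iv _] i vu.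
apply: (local_exchange P_up f_min f_attained f_socle Iu Iv _ vu).
(* A monomial [w] of [I] attaining [f setT] below [u] equals [u] by minimality, so [u] is tight on
   [setT]. *)
have [|w [Pw wu <-]] := f_attained setT u; first by exists u.
by rewrite (umin w) //; apply/mnm_lepP => k; apply: wu; rewrite inE.
Qed.

End Localization.

Theorem proposition1p19 (K : fieldType) (I : {mpoly K[4]} -> Prop) (d : nat)
  (hI : monomial_ideal I) (hd : generated_in_degree I d) :
  polymatroidal I <->
  (forall p : {mpoly K[4]} -> Prop, monomial_prime p ->
     has_linear_resolution (monomial_localization I p)).
Proof.
split=> [polI p _|LI]; first exact: polymatroidal_localize.
apply: polymatroidal_of_localize => // [|A]; first by exists d.
by have [p pp <-] := exists_monomial_prime K A; apply: LI.
Qed.
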